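(* Let $S$ be a commutative ring, let $f_1,\dots,f_c$ be a regular sequence in $S$, let $R=S/(f_1,\dots,f_c)$, and let $\mathbf K=\mathbf K(f_1,\dots,f_c)$ be the Koszul complex. If $\mathbf G:\cdots\xrightarrow{t_1'}G_p\xrightarrow{t_1'}G_{p-1}\xrightarrow{t_1'}\cdots\xrightarrow{t_1'}G_0$ is a sequence of maps of free $S$-modules such that $R\otimes_S\mathbf G$ is an $R$-free resolution of an $R$-module $M$, and $\{t_i\}_{i\ge0}$ is a system of higher CI operators for $\mathbf G$, then the complex $$\mathbf{GK}:\quad\cdots\to\bigoplus_{i+j=n}G_i\otimes_SK_j\xrightarrow{T_n}\bigoplus_{i+j=n-1}G_i\otimes_SK_j\to\cdots\to G_0\otimes K_0,$$ with $T_n$ the map whose component $G_p\otimes K_q\to G_{p-i}\otimes K_{q+i-1}$ (for $p+q=n$) is $t_i^{p,q}$, is an $S$-free resolution of $M$.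
   Context: Let $K_q=\bigwedge^qS^c$ and let $t_0'^q:K_q\to K_{q-1}$ be the Koszul differential. A system of higher CI operators for $\mathbf G$ is a family of operators $t_i=\sum_{p,q}t_i^{p,q}$, $i\ge0$, on $\mathbf G\otimes_S\mathbf K$ with components $t_i^{p,q}:G_p\otimes K_q\to G_{p-i}\otimes K_{q+i-1}$ ($i,q\ge0$, $p\ge i$) such that: for $i\ge1$, $t_i$ commutes with the natural (right) action of $\bigwedge S^c$ on $\mathbf K$, i.e. $t_i(g\otimes x\wedge y)=t_i(g\otimes x)\wedge y$; $t_0^{p,q}=1\otimes(-1)^pt_0'^q$; $t_1=t_1'\otimes1$; and $\sum_{i+j=n}t_it_j=0$ for all $n$. Such systems exist whenever $R\otimes_S\mathbf G$ is a complex. Components with a negative index are zero; $\mathbf{GK}$ is a complex. *)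

(* Defs.v *)
From HB Require Import structures.
From mathcomp Require Import all_boot all_algebra.
From mathcomp Require Import boolp.

Set Implicit Arguments.
Unset Strict Implicit.
Unset Printing Implicit Defensive.

Import GRing.Theory.
Local Open Scope ring_scope.
Local Open Scope quotient_scope.

Section FreeModules.
Variables (A : pzRingType) (V : lmodType A).

Definition is_basis (B : V -> Prop) : Prop :=
  (forall v : V, exists (s : seq V) (a : V -> A),
     (forall x, x \in s -> B x) /\ v = \sum_(x <- s) a x *: x) /\
  (forall (s : seq V) (a : V -> A), uniq s -> (forall x, x \in s -> B x) ->
     \sum_(x <- s) a x *: x = 0 -> forall x, x \in s -> a x = 0).

Definition free_module : Prop := exists B : V -> Prop, is_basis B.

End FreeModules.

Definition exact_at (A : pzRingType) (U V W : lmodType A)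
    (g : {linear U -> V}) (h : {linear V -> W}) : Prop :=
  forall x : V, h x = 0 <-> exists y : U, g y = x.

Definition is_free_resolution (A : pzRingType) (F : nat -> lmodType A)
    (d : forall n, {linear F n.+1 -> F n}) (M : lmodType A) : Prop :=
  [/\ forall n, free_module (F n),
      forall n, exact_at (d n.+1) (d n) &
      exists eps : {linear F 0%N -> M},
        exact_at (d 0%N) eps /\ forall m : M, exists x : F 0%N, eps x = m].

Arguments is_free_resolution {A} F d M.

(* [M (x)_S N] is the commutative monoid of formal sums of pairs, modulo the
   congruence generated by the bilinearity relations (this monoid is a group,
   with opposite (-1) *: _). *)
Section Tensor.
Variables (S : comPzRingType) (M N : lmodType S).

Inductive tensor_eqv : seq (M * N) -> seq (M * N) -> Prop :=
| TEqvRefl s : tensor_eqv s s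
| TEqvSym s t : tensor_eqv s t -> tensor_eqv t s
| TEqvTrans s t u : tensor_eqv s t -> tensor_eqv t u -> tensor_eqv s u
| TEqvCat s s' t t' :
    tensor_eqv s s' -> tensor_eqv t t' -> tensor_eqv (s ++ t) (s' ++ t')
| TEqvCatC s t : tensor_eqv (s ++ t) (t ++ s)
| TEqv0l n : tensor_eqv [:: (0, n)] [::]
| TEqv0r m : tensor_eqv [:: (m, 0)] [::]
| TEqvDl m m' n : tensor_eqv [:: (m, n); (m', n)] [:: (m + m', n)]
| TEqvDr m n n' : tensor_eqv [:: (m, n); (m, n')] [:: (m, n + n')]
| TEqvZ a m n : tensor_eqv [:: (a *: m, n)] [:: (m, a *: n)].

Definition tensor_rel (s t : seq (M * N)) : bool := `[< tensor_eqv s t >].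

Fact tensor_rel_refl : reflexive tensor_rel.
Proof. by move=> s; apply/asboolP; constructor. Qed.

Fact tensor_rel_sym : symmetric tensor_rel.
Proof. by move=> s t; apply/asboolP/asboolP; apply: TEqvSym. Qed.

Fact tensor_rel_trans : transitive tensor_rel.
Proof.
by move=> t s u /asboolP st /asboolP tu; apply/asboolP; apply: TEqvTrans tu.
Qed.

Canonical tensor_equiv :=
  EquivRel tensor_rel tensor_rel_refl tensor_rel_sym tensor_rel_trans.

Definition tensor : Type := {eq_quot tensor_rel}.

HB.instance Definition _ := Choice.on tensor.
HB.instance Definition _ := EqQuotient.on tensor.

Definition tsum (s : seq (M * N)) : tensor := \pi_tensor s.

Definition tens (m : M) (n : N) : tensor := tsum [:: (m, n)].

Definition tensor_scale_seq (a : S) (s : seq (M * N)) : seq (M * N) :=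
  [seq (a *: u.1, u.2) | u <- s].

Definition tensor_zero : tensor := tsum [::].
Definition tensor_add (x y : tensor) : tensor := tsum (repr x ++ repr y).
Definition tensor_scale (a : S) (x : tensor) : tensor :=
  tsum (tensor_scale_seq a (repr x)).
Definition tensor_opp (x : tensor) : tensor := tensor_scale (- 1) x.

Lemma tsumP s t : tensor_eqv s t <-> tsum s = tsum t.
Proof.
split=> [st | /eqmodP/asboolP //].
by apply/eqmodP/asboolP.
Qed.

Lemma tsum_repr (x : tensor) : tsum (repr x) = x.
Proof. exact: reprK. Qed.

Lemma repr_tsum s : tensor_eqv (repr (tsum s)) s.
Proof. by apply/tsumP; rewrite tsum_repr. Qed.

Lemma tensor_eqv_scale a s t :
  tensor_eqv s t -> tensor_eqv (tensor_scale_seq a s) (tensor_scale_seq a t).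
Proof.
rewrite /tensor_scale_seq; elim=> {s t} /=.
- by move=> s; apply: TEqvRefl.
- by move=> s t _; apply: TEqvSym.
- by move=> s t u _ st _; apply: TEqvTrans.
- by move=> s s' t t' _ ss _ tt; rewrite !map_cat; apply: TEqvCat.
- by move=> s t; rewrite !map_cat; apply: TEqvCatC.
- by move=> n; rewrite scaler0; apply: TEqv0l.
- by move=> m; apply: TEqv0r.
- by move=> m m' n; rewrite scalerDr; apply: TEqvDl.
- by move=> m n n'; apply: TEqvDr.
- by move=> b m n; rewrite scalerA mulrC -scalerA; apply: TEqvZ.
Qed.

Lemma tensor_addE s t : tensor_add (tsum s) (tsum t) = tsum (s ++ t).
Proof. by apply/tsumP; apply: TEqvCat; apply: repr_tsum. Qed.

Lemma tensor_scaleE a s :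
  tensor_scale a (tsum s) = tsum (tensor_scale_seq a s).
Proof. by apply/tsumP; apply: tensor_eqv_scale; apply: repr_tsum. Qed.

Lemma tsumW (P : tensor -> Prop) : (forall s, P (tsum s)) -> forall x, P x.
Proof. by move=> Ps x; rewrite -[x]tsum_repr. Qed.

Fact tensor_addA : associative tensor_add.
Proof.
elim/tsumW=> s; elim/tsumW=> t; elim/tsumW=> u.
by rewrite !tensor_addE catA.
Qed.

Fact tensor_addC : commutative tensor_add.
Proof.
elim/tsumW=> s; elim/tsumW=> t; rewrite !tensor_addE.
by apply/tsumP; apply: TEqvCatC.
Qed.

Fact tensor_add0 : left_id tensor_zero tensor_add.
Proof. by elim/tsumW=> s; rewrite tensor_addE. Qed.

Fact tensor_scaleDl x a b :
  tensor_scale (a + b) x = tensor_add (tensor_scale a x) (tensor_scale b x).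
Proof.
elim/tsumW: x => s; rewrite !tensor_scaleE tensor_addE.
apply/tsumP; elim: s => [|[m n] s IHs] /=; first exact: TEqvRefl.
pose sa := tensor_scale_seq a s; pose sb := tensor_scale_seq b s.
rewrite -/sa -/sb.
apply: (@TEqvTrans _ ([:: (a *: m, n); (b *: m, n)] ++ (sa ++ sb))).
  rewrite -[_ :: _]cat1s; apply: TEqvCat => //.
  by rewrite scalerDl; apply: TEqvSym; apply: TEqvDl.
have -> : [:: (a *: m, n); (b *: m, n)] ++ (sa ++ sb) =
  [:: (a *: m, n)] ++ (([:: (b *: m, n)] ++ sa) ++ sb) by [].
have -> : (a *: m, n) :: sa ++ (b *: m, n) :: sb =
  [:: (a *: m, n)] ++ ((sa ++ [:: (b *: m, n)]) ++ sb) by rewrite -catA.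
apply: TEqvCat; first exact: TEqvRefl.
by apply: TEqvCat; [apply: TEqvCatC | apply: TEqvRefl].
Qed.

Fact tensor_scale0 x : tensor_scale 0 x = tensor_zero.
Proof.
elim/tsumW: x => s; rewrite tensor_scaleE; apply/tsumP.
elim: s => [|[m n] s IHs] /=; first exact: TEqvRefl.
rewrite -[_ :: _]cat1s -[[::]]cats0; apply: TEqvCat => //.
by rewrite scale0r; apply: TEqv0l.
Qed.

Fact tensor_scale1 : left_id 1 tensor_scale.
Proof.
elim/tsumW=> s; rewrite tensor_scaleE /tensor_scale_seq; congr tsum.
by rewrite -[RHS]map_id; apply: eq_map => -[m n] /=; rewrite scale1r.
Qed.

Fact tensor_addN : left_inverse tensor_zero tensor_opp tensor_add.
Proof.
move=> x; rewrite -{2}[x]tensor_scale1 /tensor_opp -tensor_scaleDl.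
by rewrite addNr tensor_scale0.
Qed.

HB.instance Definition _ :=
  GRing.isZmodule.Build tensor tensor_addA tensor_addC tensor_add0 tensor_addN.

Fact tensor_scaleA a b x :
  tensor_scale a (tensor_scale b x) = tensor_scale (a * b) x.
Proof.
elim/tsumW: x => s; rewrite !tensor_scaleE /tensor_scale_seq -map_comp.
by congr tsum; apply: eq_map => -[m n] /=; rewrite scalerA.
Qed.

Fact tensor_scaleDr : right_distributive tensor_scale +%R.
Proof.
move=> a; elim/tsumW=> s; elim/tsumW=> t.
rewrite /GRing.add /= tensor_addE !tensor_scaleE tensor_addE.
by rewrite /tensor_scale_seq map_cat.
Qed.

HB.instance Definition _ := GRing.Zmodule_isLmodule.Build S tensor
  tensor_scaleA tensor_scale1 tensor_scaleDr
  (fun x a b => tensor_scaleDl x a b).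

Lemma tsum_cat s t : tsum (s ++ t) = tsum s + tsum t.
Proof. by rewrite -tensor_addE. Qed.

Lemma tsumE s : tsum s = \sum_(u <- s) tens u.1 u.2.
Proof.
elim: s => [|u s IHs]; first by rewrite big_nil.
by rewrite big_cons -IHs -cat1s tsum_cat; case: u.
Qed.

Lemma tensDl n : {morph tens^~ n : m m' / m + m'}.
Proof.
move=> m m'; rewrite /tens -tsum_cat.
by apply/tsumP; apply: TEqvSym; apply: TEqvDl.
Qed.

Lemma tensDr m : {morph tens m : n n' / n + n'}.
Proof.
move=> n n'; rewrite /tens -tsum_cat.
by apply/tsumP; apply: TEqvSym; apply: TEqvDr.
Qed.

Lemma tensZl a m n : tens (a *: m) n = a *: tens m n.
Proof. by rewrite [RHS](tensor_scaleE a [:: (m, n)]). Qed.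

Lemma tensZr a m n : tens m (a *: n) = a *: tens m n.
Proof. by rewrite -tensZl; apply/esym/tsumP; apply: TEqvZ. Qed.

Lemma tensor_ind (P : tensor -> Prop) :
  P 0 -> (forall x y, P x -> P y -> P (x + y)) -> (forall m n, P (tens m n)) ->
  forall x, P x.
Proof.
move=> P0 PD Pt; elim/tsumW=> s; rewrite tsumE.
by apply: big_ind => // u _.
Qed.

Lemma tensor_ext (P : lmodType S) (f g : {linear tensor -> P}) :
  (forall m n, f (tens m n) = g (tens m n)) -> f =1 g.
Proof.
move=> fg; elim/tensor_ind=> [|x y Hx Hy|//]; first by rewrite !linear0.
by rewrite !linearD Hx Hy.
Qed.

Section Lift.
Variables (P : lmodType S) (h : M -> N -> P).

Definition bilinear_map : Prop :=
  (forall n, linear (h^~ n)) /\ (forall m, linear (h m)).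

Definition tensor_lift (x : tensor) : P := \sum_(u <- repr x) h u.1 u.2.

Hypothesis h_bilin : bilinear_map.

Let hDl n m m' : h (m + m') n = h m n + h m' n.
Proof. by case: h_bilin => /(_ n 1 m m'); rewrite !scale1r. Qed.
Let hDr m n n' : h m (n + n') = h m n + h m n'.
Proof. by case: h_bilin => _ /(_ m 1 n n'); rewrite !scale1r. Qed.
Let h0l n : h 0 n = 0.
Proof. by apply: (addrI (h 0 n)); rewrite -hDl !addr0. Qed.
Let h0r m : h m 0 = 0.
Proof. by apply: (addrI (h m 0)); rewrite -hDr !addr0. Qed.
Let hZl a m n : h (a *: m) n = a *: h m n.
Proof. by case: h_bilin => /(_ n a m 0); rewrite !addr0 h0l addr0. Qed.
Let hZr a m n : h m (a *: n) = a *: h m n.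
Proof. by case: h_bilin => _ /(_ m a n 0); rewrite !addr0 h0r addr0. Qed.

Let lift_eqv s t : tensor_eqv s t ->
  \sum_(u <- s) h u.1 u.2 = \sum_(u <- t) h u.1 u.2.
Proof.
elim=> {s t} [s|s t _ -> //|s t u _ -> _ -> //|s s' t t' _ ss _ tt|s t|n|m
  |m m' n|m n n'|a m n]; rewrite ?big_cat ?big_cons ?big_nil /= ?addr0 //.
- by rewrite ss tt.
- exact: addrC.
- by rewrite hZl hZr.
Qed.

Lemma tensor_lift_tsum s : tensor_lift (tsum s) = \sum_(u <- s) h u.1 u.2.
Proof. by apply: lift_eqv; apply: repr_tsum. Qed.

Lemma tensor_lift_tens m n : tensor_lift (tens m n) = h m n.
Proof. by rewrite tensor_lift_tsum big_seq1. Qed.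

Lemma tensor_lift_linear : linear tensor_lift.
Proof.
move=> a; elim/tsumW=> s; elim/tsumW=> t.
have -> : a *: tsum s + tsum t = tsum (tensor_scale_seq a s ++ t).
  by rewrite tsum_cat -tensor_scaleE.
rewrite !tensor_lift_tsum big_cat big_map scaler_sumr /=; congr (_ + _).
by apply: eq_bigr => u _; rewrite hZl.
Qed.

End Lift.
End Tensor.

Section TensorMap.
Variables (S : comPzRingType) (M M' N N' : lmodType S).
Variables (f : {linear M -> M'}) (g : {linear N -> N'}).

Definition tensor_map : tensor M N -> tensor M' N' :=
  tensor_lift (fun m n => tens (f m) (g n)).

Fact tensor_map_bilinear : bilinear_map (fun m n => tens (f m) (g n)).
Proof.
split=> [n a m m' | m a n n'].
  by rewrite linearP tensDl tensZl.
by rewrite linearP tensDr tensZr.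
Qed.

Lemma tensor_map_tens m n : tensor_map (tens m n) = tens (f m) (g n).
Proof. exact: (tensor_lift_tens tensor_map_bilinear). Qed.

HB.instance Definition _ := GRing.isLinear.Build S (tensor M N)
  (tensor M' N') *:%R tensor_map (tensor_lift_linear tensor_map_bilinear).

End TensorMap.

Definition restrict (A B : pzRingType) (phi : {rmorphism A -> B})
  (M : lmodType B) : Type := M.

Section RestrictScalars.
Variables (A B : pzRingType) (phi : {rmorphism A -> B}) (M : lmodType B).

Local Notation restrict := (restrict phi M).

HB.instance Definition _ := GRing.Zmodule.on restrict.

Definition restrict_scale (a : A) (x : restrict) : restrict :=
  phi a *: (x : M).

Fact restrict_scaleA a b x :
  restrict_scale a (restrict_scale b x) = restrict_scale (a * b) x.
Proof. by rewrite /restrict_scale scalerA rmorphM. Qed.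

Fact restrict_scale1 : left_id 1 restrict_scale.
Proof. by move=> x; rewrite /restrict_scale rmorph1 scale1r. Qed.

Fact restrict_scaleDr : right_distributive restrict_scale +%R.
Proof. by move=> a x y; apply: scalerDr. Qed.

Fact restrict_scaleDl x : {morph restrict_scale^~ x : a b / a + b}.
Proof. by move=> a b; rewrite /restrict_scale rmorphD scalerDl. Qed.

HB.instance Definition _ := GRing.Zmodule_isLmodule.Build A restrict
  restrict_scaleA restrict_scale1 restrict_scaleDr restrict_scaleDl.

End RestrictScalars.

(* [base_change phi M] is B (x)_A M, with B acting on the left factor. *)
Section BaseChange.
Variables (A B : comPzRingType) (phi : {rmorphism A -> B}).

Definition scalars : lmodType A := restrict phi B^o.

Definition scalars_mul (b : B) (x : scalars) : scalars := b * (x : B).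

Fact scalars_mul_linear b : linear (scalars_mul b).
Proof.
move=> a x y; rewrite /scalars_mul mulrDr; congr (_ + _).
by rewrite /GRing.scale /= /restrict_scale /GRing.scale /= mulrCA.
Qed.

HB.instance Definition _ b := GRing.isLinear.Build A scalars scalars *:%R
  (scalars_mul b) (scalars_mul_linear b).

Section Module.
Variable M : lmodType A.

Definition base_change : Type := tensor scalars M.

HB.instance Definition _ := GRing.Zmodule.on base_change.

Definition base_change_scale (b : B) (x : base_change) : base_change :=
  tensor_map (scalars_mul b) (@idfun M) x.

Fact base_change_scaleA a b x :
  base_change_scale a (base_change_scale b x) = base_change_scale (a * b) x.
Proof.
pose mu d : {linear tensor scalars M -> tensor scalars M} :=
  tensor_map (scalars_mul d) (@idfun M).
apply: (@tensor_ext _ _ _ _ (mu a \o mu b) (mu (a * b))) => m n /=.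
by rewrite !tensor_map_tens; congr tens; apply: mulrA.
Qed.

Fact base_change_scale1 : left_id 1 base_change_scale.
Proof.
apply: (@tensor_ext _ _ _ _ (tensor_map (scalars_mul 1) (@idfun M)) idfun).
move=> m n /=; rewrite tensor_map_tens; congr tens; apply: mul1r.
Qed.

Fact base_change_scaleDr : right_distributive base_change_scale +%R.
Proof. by move=> a x y; apply: linearD. Qed.

Fact base_change_scaleDl x : {morph base_change_scale^~ x : a b / a + b}.
Proof.
move=> a b.
pose mu d : {linear tensor scalars M -> tensor scalars M} :=
  tensor_map (scalars_mul d) (@idfun M).
apply: (@tensor_ext _ _ _ _ (mu (a + b)) (mu a \+ mu b)) => m n /=.
by rewrite !tensor_map_tens -tensDl; congr tens; apply: mulrDl.
Qed.

HB.instance Definition _ := GRing.Zmodule_isLmodule.Build B base_change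
  base_change_scaleA base_change_scale1 base_change_scaleDr base_change_scaleDl.

End Module.

Section Map.
Variables (M N : lmodType A) (g : {linear M -> N}).

Definition base_change_map : base_change M -> base_change N :=
  tensor_map (@idfun scalars) g.

Fact base_change_map_linear : linear base_change_map.
Proof.
move=> b x y; rewrite /base_change_map linearD; congr (_ + _).
pose mu L : {linear tensor scalars L -> tensor scalars L} :=
  tensor_map (scalars_mul b) (@idfun L).
pose g' : {linear tensor scalars M -> tensor scalars N} :=
  tensor_map (@idfun scalars) g.
apply: (@tensor_ext _ _ _ _ (g' \o mu M) (mu N \o g')) => m n /=.
by rewrite !tensor_map_tens.
Qed.

HB.instance Definition _ := GRing.isLinear.Build B (base_change M)
  (base_change N) *:%R base_change_map base_change_map_linear.

End Map.
End BaseChange.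

Arguments base_change {A B} phi M.
Arguments base_change_map {A B} phi {M N} g x.

Section QuotientRing.
Variables (S : comPzRingType) (c : nat) (f : 'I_c -> S).

Definition gen_ideal (P : pred 'I_c) : {pred S} :=
  fun a => `[< exists u : 'I_c -> S, a = \sum_(i | P i) u i * f i >].

Definition regular_sequence : Prop :=
  (forall (i : 'I_c) (a : S),
     f i * a \in gen_ideal [pred j : 'I_c | (j < i)%N] ->
     a \in gen_ideal [pred j : 'I_c | (j < i)%N]) /\
  1 \notin gen_ideal predT.

Fact gen_ideal_zmod_closed P : zmod_closed (gen_ideal P).
Proof.
split=> [|a b /asboolP[u ->] /asboolP[v ->]]; apply/asboolP.
  by exists (fun=> 0); rewrite big1 // => i _; rewrite mul0r.
exists (fun i => u i - v i); rewrite -sumrB.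
by apply: eq_bigr => i _; rewrite mulrBl.
Qed.

HB.instance Definition _ P :=
  GRing.isZmodClosed.Build S (gen_ideal P) (gen_ideal_zmod_closed P).

Lemma gen_idealMl P a b : b \in gen_ideal P -> a * b \in gen_ideal P.
Proof.
move=> /asboolP[u ->]; apply/asboolP; exists (fun i => a * u i).
by rewrite mulr_sumr; apply: eq_bigr => i _; rewrite mulrA.
Qed.

Definition quot_ring : Type := Quotient.quot (gen_ideal predT).

HB.instance Definition _ := GRing.Zmodule.on quot_ring.

Definition quot_proj (a : S) : quot_ring :=
  \pi_(Quotient.quot (gen_ideal predT)) a.

Definition quot_repr (x : quot_ring) : S :=
  repr (x : Quotient.quot (gen_ideal predT)).

Definition quot_one : quot_ring := quot_proj 1.
Definition quot_mul (x y : quot_ring) : quot_ring :=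
  quot_proj (quot_repr x * quot_repr y).

Lemma quot_reprK x : quot_proj (quot_repr x) = x.
Proof. exact: reprK. Qed.

Lemma quot_projP a b : quot_proj a = quot_proj b <-> a - b \in gen_ideal predT.
Proof. by rewrite Quotient.idealrBE; split=> [/eqP | H]; [|apply/eqP]. Qed.

Fact quot_proj_zmod_morphism : zmod_morphism quot_proj.
Proof. by move=> a b; rewrite /quot_proj raddfB. Qed.

HB.instance Definition _ := GRing.isZmodMorphism.Build S quot_ring quot_proj
  quot_proj_zmod_morphism.

Lemma quot_projM a b : quot_proj (a * b) = quot_mul (quot_proj a) (quot_proj b).
Proof.
set a' := quot_repr (quot_proj a); set b' := quot_repr (quot_proj b).
have /quot_projP Ha : quot_proj a = quot_proj a' by rewrite quot_reprK.
have /quot_projP Hb : quot_proj b = quot_proj b' by rewrite quot_reprK.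
apply/quot_projP.
have -> : a * b - a' * b' = b * (a - a') + a' * (b - b').
  by rewrite !mulrBr [b * a]mulrC [b * a']mulrC addrA subrK.
by rewrite rpredD // gen_idealMl.
Qed.

Fact quot_mulA : associative quot_mul.
Proof.
move=> x y z; rewrite -[x]quot_reprK -[y]quot_reprK -[z]quot_reprK.
by rewrite -!quot_projM mulrA.
Qed.

Fact quot_mulC : commutative quot_mul.
Proof.
move=> x y; rewrite -[x]quot_reprK -[y]quot_reprK.
by rewrite -!quot_projM mulrC.
Qed.

Fact quot_mul1 : left_id quot_one quot_mul.
Proof. by move=> x; rewrite -[x]quot_reprK -quot_projM mul1r. Qed.

Fact quot_mulDl : left_distributive quot_mul +%R.
Proof.
move=> x y z; rewrite -[x]quot_reprK -[y]quot_reprK -[z]quot_reprK.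
by rewrite -raddfD -!quot_projM -raddfD mulrDl.
Qed.

HB.instance Definition _ := GRing.Zmodule_isComPzRing.Build quot_ring
  quot_mulA quot_mulC quot_mul1 quot_mulDl.

Fact quot_proj_monoid_morphism : monoid_morphism quot_proj.
Proof. by split=> // a b; apply: quot_projM. Qed.

HB.instance Definition _ := GRing.isMonoidMorphism.Build S quot_ring quot_proj
  quot_proj_monoid_morphism.

End QuotientRing.

(* An element of the q-th exterior power of S^c is given by its coordinates on
   the basis e_I = e_{i_1} /\ ... /\ e_{i_q}, with I = {i_1 < ... < i_q}. *)
Section Koszul.
Variables (S : comPzRingType) (c : nat).

Definition subsets (q : nat) : Type := {I : {set 'I_c} | #|I| == q}.
HB.instance Definition _ q := Finite.on (subsets q).

Definition exterior (q : nat) : lmodType S := {ffun subsets q -> S^o}.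

(* e_I /\ e_J = (-1)^(inversions I J) e_(I :|: J) if I, J are disjoint, and 0
   otherwise; [wedge y x] is x /\ y, so that [wedge y] is the right action of y. *)
Definition inversions (I J : {set 'I_c}) : nat :=
  #|[set u : 'I_c * 'I_c | [&& u.1 \in I, u.2 \in J & (u.2 < u.1)%N]]|.

Definition wedge (q r : nat) (y : exterior r) (x : exterior q) :
    exterior (q + r) :=
  [ffun L : subsets (q + r) =>
    \sum_(I : subsets q)
      \sum_(J : subsets r |
             [disjoint val I & val J] && (val I :|: val J == val L))
        (-1) ^+ inversions (val I) (val J) * (x I : S) * (y J : S)].

Fact wedge_linear q r y : linear (@wedge q r y).
Proof.
move=> a x x'; apply/ffunP => L; rewrite !ffunE /=.
rewrite /GRing.scale /= mulr_sumr -big_split /=; apply: eq_bigr => I _.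
rewrite mulr_sumr -big_split /=; apply: eq_bigr => J _.
by rewrite !ffunE mulrDr mulrDl; congr (_ + _); rewrite /GRing.scale /= -!mulrA mulrCA.
Qed.

HB.instance Definition _ q r y := GRing.isLinear.Build S (exterior q)
  (exterior (q + r)) *:%R (@wedge q r y) (wedge_linear y).

Variable f : 'I_c -> S.

(* e_I |-> \sum_(k in I) (-1)^#{j in I, j < k} f_k e_(I :\ k) *)
Definition koszul_diff (q : nat) (x : exterior q.+1) : exterior q :=
  [ffun J : subsets q =>
    \sum_(I : subsets q.+1)
      \sum_(k in val I | val I :\ k == val J)
        (-1) ^+ #|[set j in val I | (j < k)%N]| * f k * (x I : S)].

Fact koszul_diff_linear q : linear (@koszul_diff q).
Proof.
move=> a x x'; apply/ffunP => J; rewrite !ffunE /=.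
rewrite /GRing.scale /= mulr_sumr -big_split /=; apply: eq_bigr => I _.
rewrite mulr_sumr -big_split /=; apply: eq_bigr => k _.
by rewrite !ffunE mulrDr; congr (_ + _); rewrite /GRing.scale /= mulrCA.
Qed.

HB.instance Definition _ q := GRing.isLinear.Build S (exterior q.+1)
  (exterior q) *:%R (@koszul_diff q) (@koszul_diff_linear q).

End Koszul.

Section DirectSum.
Variables (S : pzRingType) (n : nat) (V : 'I_n -> lmodType S).

Definition dsum : Type := {dffun forall i : 'I_n, V i}.
HB.instance Definition _ := Choice.on dsum.

Definition dsum_zero : dsum := [ffun i => 0].
Definition dsum_opp (x : dsum) : dsum := [ffun i => - x i].
Definition dsum_add (x y : dsum) : dsum := [ffun i => x i + y i].
Definition dsum_scale (a : S) (x : dsum) : dsum := [ffun i => a *: x i].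

Fact dsum_addA : associative dsum_add.
Proof. by move=> x y z; apply/ffunP=> i; rewrite !ffunE addrA. Qed.
Fact dsum_addC : commutative dsum_add.
Proof. by move=> x y; apply/ffunP=> i; rewrite !ffunE addrC. Qed.
Fact dsum_add0 : left_id dsum_zero dsum_add.
Proof. by move=> x; apply/ffunP=> i; rewrite !ffunE add0r. Qed.
Fact dsum_addN : left_inverse dsum_zero dsum_opp dsum_add.
Proof. by move=> x; apply/ffunP=> i; rewrite !ffunE addNr. Qed.

HB.instance Definition _ :=
  GRing.isZmodule.Build dsum dsum_addA dsum_addC dsum_add0 dsum_addN.

Fact dsum_scaleA a b x : dsum_scale a (dsum_scale b x) = dsum_scale (a * b) x.
Proof. by apply/ffunP=> i; rewrite !ffunE scalerA. Qed.
Fact dsum_scale1 : left_id 1 dsum_scale.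
Proof. by move=> x; apply/ffunP=> i; rewrite !ffunE scale1r. Qed.
Fact dsum_scaleDr : right_distributive dsum_scale +%R.
Proof. by move=> a x y; apply/ffunP=> i; rewrite !ffunE scalerDr. Qed.
Fact dsum_scaleDl x : {morph dsum_scale^~ x : a b / a + b}.
Proof. by move=> a b; apply/ffunP=> i; rewrite !ffunE scalerDl. Qed.

HB.instance Definition _ := GRing.Zmodule_isLmodule.Build S dsum
  dsum_scaleA dsum_scale1 dsum_scaleDr dsum_scaleDl.

End DirectSum.

Section HigherCI.
Variables (S : comPzRingType) (c : nat) (f : 'I_c -> S).
Variable G : nat -> lmodType S.

Definition GK_term (p q : nat) : lmodType S := tensor (G p) (exterior S c q).

(* [t i p q p' q'] is the component G_p (x) K_q -> G_p' (x) K_q' of t_i.  Only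
   those with p' = p - i and q' = q + i - 1 (integer subtraction) belong to the
   family; the others are junk and are never used below. *)
Definition operators : Type :=
  forall i p q p' q' : nat, {linear GK_term p q -> GK_term p' q'}.

Variables (dG : forall p, {linear G p.+1 -> G p}) (t : operators).

Record higher_CI_operators : Prop := HigherCIOperators {
  CI_right_linear : forall i p q p' q' r, (0 < i)%N ->
    p = (p' + i)%N -> (q + i)%N = q'.+1 ->
    forall (g : G p) (x : exterior S c q) (y : exterior S c r),
      t i p (q + r)%N p' (q' + r)%N (tens g (wedge y x)) =
      tensor_map (@idfun (G p')) (@wedge S c q' r y)
        (t i p q p' q' (tens g x));
  CI_t0 : forall p q (g : G p) (x : exterior S c q.+1),
    t 0%N p q.+1 p q (tens g x) = tens g ((-1) ^+ p *: koszul_diff f x);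
  CI_t1 : forall p q (z : GK_term p.+1 q),
    t 1%N p.+1 q p q z = tensor_map (dG p) (@idfun (exterior S c q)) z;
  (* t_j lands in G_(p-j) (x) K_(q+j-1), which is zero when q = j = 0. *)
  CI_comp : forall n p q p' q', p = (p' + n)%N -> (q + n)%N = q'.+2 ->
    forall z : GK_term p q,
      \sum_(j < n.+1 | (0 < q + j)%N)
        t (n - j)%N (p - j)%N (q + j).-1%N p' q'
          (t j p q (p - j)%N (q + j).-1%N z) = 0
}.

Definition GK (n : nat) : lmodType S :=
  dsum (fun p : 'I_n.+1 => GK_term p (n - p)%N).

Definition GK_diff (n : nat) (x : GK n.+1) : GK n :=
  [ffun p' : 'I_n.+1 =>
    \sum_(p : 'I_n.+2 | (p' <= p)%N)
      t (p - p')%N p (n.+1 - p)%N p' (n - p')%N (x p)].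

Fact GK_diff_linear n : linear (@GK_diff n).
Proof.
move=> a x y; apply/ffunP=> p'; rewrite !ffunE.
rewrite scaler_sumr -big_split /=; apply: eq_bigr => p _.
by rewrite !ffunE linearP.
Qed.

HB.instance Definition _ n := GRing.isLinear.Build S (GK n.+1) (GK n) *:%R
  (@GK_diff n) (@GK_diff_linear n).

End HigherCI.

Arguments GK_diff {S c G} t n x.

(* Main.v *)
Require Import Defs.
From HB Require Import structures.
From mathcomp Require Import all_boot all_algebra.
From mathcomp Require Import boolp zify.

(* Filter GK by the index p of G_p (x) K_q.  The part of T preserving p is the
   Koszul differential t_0, and as f is a regular sequence and G_p is free,
   G_p (x) K is exact in degrees q > 0, with cokernel R (x) G_p.  Hence the
   projection of GK_n onto its top component G_n (x) K_0 = G_n, reduced modulo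
   (f_1, ..., f_c), is a surjective chain map rho : GK -> R (x) G, because only
   t_0 and t_1 = t_1' reach the top component.  Given a cycle x of GK, exactness
   of R (x) G and surjectivity of rho give y with rho (x - T y) = 0; the
   components of x - T y are then killed one after the other, by decreasing p,
   by subtracting boundaries of Koszul preimages. *)

Set Implicit Arguments.
Unset Strict Implicit.
Unset Printing Implicit Defensive.

Import GRing.Theory.
Local Open Scope ring_scope.

(** * Bases and free modules *)

Lemma sum_collect (A : pzRingType) (V : lmodType A) (I : eqType) (r : seq I)
    (a : I -> A) (v : I -> V) (s : seq V) :
  uniq s -> {in r, forall i, v i \in s} ->
  \sum_(i <- r) a i *: v i =
  \sum_(x <- s) (\sum_(i <- r | v i == x) a i) *: x.
Proof.
move=> s_uniq vs.
transitivity (\sum_(x <- s) \sum_(i <- r | v i == x) a i *: v i).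
  rewrite (exchange_big_dep predT) //=; apply: eq_big_seq => i /vs vis.
  rewrite -big_filter (eq_filter (a2 := pred1 (v i))); last first.
    by move=> x; rewrite /= eq_sym.
  by rewrite filter_pred1_uniq // big_seq1.
by apply: eq_bigr => x _; rewrite scaler_suml; apply: eq_bigr => i /eqP ->.
Qed.

(** Merging the finitely many lists of basis vectors lets relations between the [v i] be compared
    coefficient by coefficient. *)
Lemma basis_common_support (A : pzRingType) (V : lmodType A) (B : V -> Prop)
    (I : finType) (v : I -> V) :
  is_basis B ->
  exists (s : seq V) (a : I -> V -> A),
    [/\ uniq s, forall x, x \in s -> B x
      & forall i, v i = \sum_(x <- s) a i x *: x].
Proof.
case=> span _.
have {span} /choice[s /choice[a sa]] i :
    exists (s : seq V) (a : V -> A),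
      (forall x, x \in s -> B x) /\ v i = \sum_(x <- s) a x *: x.
  exact: span.
pose r := undup (flatten [seq s i | i : I]).
exists r, (fun i x => \sum_(y <- s i | y == x) a i y); split.
- exact: undup_uniq.
- move=> x; rewrite mem_undup => /flatten_mapP[i _].
  by case: (sa i) => + _; apply.
move=> i; rewrite {1}(proj2 (sa i)); apply: (@sum_collect _ _ _ _ (a i) id).
  exact: undup_uniq.
move=> x xs; rewrite mem_undup; apply/flatten_mapP.
by exists i; rewrite ?mem_enum.
Qed.

(** The images of bases of the summands together form a basis of [V]. This serves both for
    [G_p (x) K_q] and for the total complex. *)
Lemma free_biproduct (A : pzRingType) (I : finType) (W : I -> lmodType A)
    (V : lmodType A) (inj : forall i, {linear W i -> V})
    (proj : forall i, {linear V -> W i}) :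
  (forall i, cancel (inj i) (proj i)) ->
  (forall i j x, i != j -> proj j (inj i x) = 0) ->
  (forall v, v = \sum_i inj i (proj i v)) ->
  (forall i, free_module (W i)) -> free_module V.
Proof.
move=> injK inj_out proj_sum freeW.
pose B i := projT1 (cid (freeW i)).
have basisB i : is_basis (B i) by rewrite /B; case: cid.
exists (fun v => exists i x, B i x /\ v = inj i x); split.
  move=> v.
  have sa i : {sa : seq (W i) * (W i -> A) |
      (forall x, x \in sa.1 -> B i x) /\
      proj i v = \sum_(x <- sa.1) sa.2 x *: x}.
    apply: cid; case: (basisB i) => /(_ (proj i v))[s [a ?]] _.
    by exists (s, a).
  pose l := [seq ((projT1 (sa i)).2 x, inj i x)
            | i <- enum I, x <- (projT1 (sa i)).1].
  (* Coefficients are functions of the vector, so those of vectors repeated in [l] are added up. *)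
  exists (undup (unzip2 l)), (fun x => \sum_(u <- l | u.2 == x) u.1); split.
    move=> x; rewrite mem_undup => /mapP[_ /allpairsPdep[i [y [_ ys ->]]] ->].
    by exists i, y; split=> //; case: (sa i) ys => /= ? [+ _]; apply.
  rewrite -(@sum_collect _ _ _ l fst snd) ?undup_uniq //; last first.
    by move=> u ul; rewrite mem_undup map_f.
  rewrite big_allpairs_dep /= big_enum /= {1}[v]proj_sum; apply: eq_bigr => i _.
  rewrite {1}(proj2 (projT2 (sa i))) linear_sum; apply: eq_bigr => x _.
  by rewrite linearZ.
move=> s a s_uniq sB sum0 x xs; case: (sB x xs) => i [b [Bb xE]].
(* Applying [proj i] to the relation keeps only the vectors of [s] coming from [W i], which leaves a
   relation between distinct basis elements there. *)
pose in_i y := `[< exists b, B i b /\ y = inj i b >].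
pose si := [seq proj i y | y <- s & in_i y].
have in_iK y : in_i y -> inj i (proj i y) = y.
  by case/asboolP=> b' [_ ->]; rewrite injK.
have si_uniq : uniq si.
  rewrite map_inj_in_uniq ?filter_uniq // => y z.
  rewrite !mem_filter => /andP[/in_iK yE _] /andP[/in_iK zE _] yz.
  by rewrite -yE yz.
have projs y : y \in s -> ~~ in_i y -> proj i y = 0.
  move=> /sB[j [b' [Bb' ->]]].
  have [ji|ji _] := eqVneq j i; last exact: inj_out.
  by move: b' Bb'; rewrite ji => b' Bb' /asboolP[]; exists b'.
have siB y : y \in si -> B i y.
  case/mapP=> z; rewrite mem_filter => /andP[/asboolP[b' [Bb' ->]] _] ->.
  by rewrite injK.
have := (proj2 (basisB i)) si (a \o inj i) si_uniq siB.
rewrite big_map big_filter /= => /(_ _ (proj i x)).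
rewrite xE injK -xE; apply.
  rewrite -[RHS](linear0 (proj i)) -sum0 linear_sum big_mkcond.
  apply: eq_big_seq => y ys; rewrite linearZ /=.
  case: ifPn => [/in_iK -> //|ne]; by rewrite projs ?scaler0.
apply/mapP; exists x; rewrite ?xE ?injK // mem_filter -xE xs andbT.
by apply/asboolP; exists b.
Qed.

(** * The Koszul complex of a regular sequence, with coefficients in a module *)

Section KoszulFunctions.
Variables (S : comPzRingType) (c : nat) (f : 'I_c -> S) (V : lmodType S).

Definition in_ideal_mul (P : pred 'I_c) (v : V) : Prop :=
  exists h : 'I_c -> V, v = \sum_(i | P i) f i *: h i.

Lemma in_ideal_mulZ P a v : in_ideal_mul P v -> in_ideal_mul P (a *: v).
Proof.
case=> h ->; exists (fun i => a *: h i); rewrite scaler_sumr.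
by apply: eq_bigr => i _; rewrite !scalerA mulrC.
Qed.

Lemma in_ideal_mulB P v w :
  in_ideal_mul P v -> in_ideal_mul P w -> in_ideal_mul P (v - w).
Proof.
move=> [h ->] [h' ->]; exists (fun i => h i - h' i); rewrite -sumrB.
by apply: eq_bigr => i _; rewrite scalerBr.
Qed.

(** Weak regularity: [V] may equal its product with the ideal, as when [V] is zero. *)
Definition regular_on : Prop := forall (i : 'I_c) (v : V),
  in_ideal_mul [pred j : 'I_c | (j < i)%N] (f i *: v) ->
  in_ideal_mul [pred j : 'I_c | (j < i)%N] v.

(** Regularity in [S] is applied to each coordinate of [v] in a basis of [V]. *)
Lemma free_regular_on :
  regular_sequence f -> free_module V -> regular_on.
Proof.
case=> f_reg _ [B basisB] i v [h hE].
(* Only the [h k] with [k < i] matter, so slot [i] is free to hold [v], and one list of basis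
   vectors serves them all. *)
pose u k := if k == i then v else h k.
have [s [a [s_uniq sB aE]]] := basis_common_support u basisB.
have uv : v = \sum_(x <- s) a i x *: x by rewrite -aE /u eqxx.
have uh (k : 'I_c) : (k < i)%N -> h k = \sum_(x <- s) a k x *: x.
  by move=> ki; rewrite -aE /u; case: eqP ki => [->|//]; rewrite ltnn.
pose b x := f i * a i x - \sum_(k : 'I_c | (k < i)%N) f k * a k x.
have b0 x : x \in s -> b x = 0.
  apply: (proj2 basisB) => //.
  transitivity (f i *: v - \sum_(k : 'I_c | (k < i)%N) f k *: h k).
    rewrite uv.
    rewrite (eq_bigr _ (fun k ki => congr1 (GRing.scale (f k)) (uh k ki))).
    rewrite scaler_sumr (eq_bigr _ (fun k ki => scaler_sumr _ _ _ _)).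
    rewrite exchange_big -sumrB /=; apply: eq_bigr => y _.
    rewrite scalerBl scalerA scaler_suml; congr (_ - _).
    by apply: eq_bigr => k _; rewrite scalerA.
  by rewrite hE subrr.
have /choice[g gE] x : exists g : 'I_c -> S,
    x \in s -> a i x = \sum_(k : 'I_c | (k < i)%N) g k * f k.
  have [xs|_] := boolP (x \in s); last by exists (fun=> 0).
  have /asboolP[g gE] : a i x \in gen_ideal f [pred j : 'I_c | (j < i)%N].
    apply: f_reg; apply/asboolP; exists (a^~ x).
    move/eqP: (b0 x xs); rewrite subr_eq0 => /eqP ->.
    by apply: eq_bigr => k _; rewrite mulrC.
  by exists g.
exists (fun k => \sum_(x <- s) g x k *: x).
rewrite uv (eq_bigr _ (fun k ki => scaler_sumr _ _ _ _)) exchange_big /=.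
apply: eq_big_seq => x /gE ->; rewrite scaler_suml.
by apply: eq_bigr => k _; rewrite scalerA mulrC.
Qed.

Implicit Types (x y : {set 'I_c} -> V) (J : {set 'I_c}) (k : 'I_c).

Definition below J k : nat := #|[set j in J | (j < k)%N]|.

(* [x : {set 'I_c} -> V] stands for the sum of all [x J (x) e_J], in all degrees
   at once. *)
Definition Koszul x J : V :=
  \sum_(k | k \notin J) ((-1) ^+ below J k * f k) *: x (k |: J).

Lemma below_setU1 J k l :
  k \notin J -> below (k |: J) l = ((k < l) + below J l)%N.
Proof.
move=> kJ; rewrite /below.
have [kl|kl] := boolP (k < l)%N.
  rewrite (_ : [set _ in _ | _] = k |: [set j in J | (j < l)%N]).
    by rewrite cardsU1 inE (negbTE kJ).
  by apply/setP=> j; rewrite !inE andb_orl; case: eqP => // ->; rewrite kl.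
apply: eq_card => j; rewrite !inE andb_orl.
by case: eqP => // ->; rewrite (negbTE kl) andbF.
Qed.

(** Such an [x] lives in the Koszul complex of the first [m] elements of the sequence. *)
Definition supported_below (m : nat) x : Prop :=
  forall J k, k \in J -> (m <= k)%N -> x J = 0.

Lemma Koszul_supported m x :
  supported_below m x -> supported_below m (Koszul x).
Proof.
move=> xm J k kJ mk; apply: big1 => l _.
by rewrite (xm _ k) ?scaler0 // inE kJ orbT.
Qed.

Lemma Koszul_set0 m x :
  supported_below m x ->
  in_ideal_mul [pred j : 'I_c | (j < m)%N] (Koszul x set0).
Proof.
move=> xm; exists (fun k => x [set k]).
rewrite /Koszul [LHS]big_mkcond [RHS]big_mkcond; apply: eq_bigr => k _ /=.
rewrite inE /= setU0; have -> : below set0 k = 0%N.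
  by apply: eq_card0 => j; rewrite !inE.
rewrite mul1r; case: ltnP => // mk.
by rewrite (xm _ k) ?scaler0 // inE.
Qed.

Section Step.
Variables (m : nat) (mc : (m < c)%N).
Let i0 := Ordinal mc.

(* [x] is [kbase x] plus, up to sign, [e_m /\ klink x]. *)
Definition kbase x J : V := if i0 \in J then 0 else x J.
Definition klink x J : V := if i0 \in J then 0 else x (i0 |: J).

Lemma kbase_supported x : supported_below m.+1 x -> supported_below m (kbase x).
Proof.
move=> xm J k kJ mk; rewrite /kbase; case: ifPn => // iJ.
apply: (xm _ k) => //; rewrite ltn_neqAle mk andbT.
by apply: contraNneq iJ => mk'; rewrite (_ : i0 = k) //; apply: val_inj.
Qed.

Lemma klink_supported x : supported_below m.+1 x -> supported_below m (klink x).
Proof.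
move=> xm J k kJ mk; rewrite /klink; case: ifPn => // iJ.
apply: (xm _ k) => //; first by rewrite inE kJ orbT.
rewrite ltn_neqAle mk andbT.
by apply: contraNneq iJ => mk'; rewrite (_ : i0 = k) //; apply: val_inj.
Qed.

(** Together with [Koszul_link], this presents the Koszul complex of the first [m.+1] elements as
    the mapping cone, up to signs, of [f i0] on that of the first [m]. *)
Lemma Koszul_base x J : i0 \notin J ->
  Koszul x J = Koszul (kbase x) J + ((-1) ^+ below J i0 * f i0) *: klink x J.
Proof.
move=> iJ; rewrite /Koszul (bigD1 i0) //= [in RHS](bigD1 i0) //=.
rewrite {1}/kbase {1}/klink setU11 (negbTE iJ) scaler0 add0r addrC.
congr (_ + _); apply: eq_bigr => k /andP[_ ki].
by rewrite /kbase !inE eq_sym (negbTE ki) (negbTE iJ).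
Qed.

(** No index above [m] occurs in [x], so inserting [i0] changes no sign in a nonzero term. *)
Lemma Koszul_link x J : supported_below m.+1 x -> i0 \notin J ->
  Koszul x (i0 |: J) = Koszul (klink x) J.
Proof.
move=> xm iJ; rewrite /Koszul [RHS](bigD1 i0) //=.
rewrite {1}/klink setU11 scaler0 add0r.
apply: eq_big => [k|k]; first by rewrite !inE negb_or andbC.
rewrite !inE negb_or => /andP[ki kJ].
rewrite /klink !inE eq_sym (negbTE ki) (negbTE iJ) /= setUCA below_setU1 //.
case: (ltnP i0 k) => // ik.
by rewrite (xm _ k) ?scaler0 // !inE eqxx orbT.
Qed.

(** Wherever [x I] is nonzero, [below I i0] is the cardinality of [I]. The twist is thus the parity
    of the degree, which the differential reverses. *)
Lemma Koszul_sign x J : supported_below m x ->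
  Koszul (fun I => (-1) ^+ below I i0 *: x I) J =
  - ((-1) ^+ below J i0 *: Koszul x J).
Proof.
move=> xm; rewrite /Koszul scaler_sumr -sumrN; apply: eq_bigr => k kJ.
rewrite below_setU1 //; have [mk|km] := leqP m k.
  by rewrite (xm _ k) ?setU11 // !scaler0 oppr0.
by rewrite /= exprS !scalerA -scaleNr mulN1r mulrN mulrC.
Qed.

End Step.

Lemma Koszul_eq x y J :
  (forall k, k \notin J -> x (k |: J) = y (k |: J)) -> Koszul x J = Koszul y J.
Proof. by move=> xy; apply: eq_bigr => k kJ; rewrite xy. Qed.

Lemma KoszulB a x y J :
  Koszul (fun I => x I - a *: y I) J = Koszul x J - a *: Koszul y J.
Proof.
rewrite /Koszul scaler_sumr -sumrB; apply: eq_bigr => k _.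
by rewrite scalerBr !scalerA (mulrC a).
Qed.

(* Induction on the number of elements of the sequence.  The degree of [x] does
   not matter: as [Koszul y] does not depend on [y set0], this value is available
   to make the degree 0 part of the cycle at the previous stage a boundary. *)
Lemma Koszul_acyclic : regular_on -> forall m x, (m <= c)%N ->
  supported_below m x -> Koszul x =1 (fun=> 0) ->
  in_ideal_mul [pred j : 'I_c | (j < m)%N] (x set0) ->
  exists y, supported_below m y /\ Koszul y =1 x.
Proof.
move=> f_reg; elim=> [|m IHm] x mc xm Kx x0.
  exists (fun=> 0); split=> // J.
  rewrite /Koszul big1 => [|k _]; last by rewrite scaler0.
  have [->|[k kJ]] := set_0Vmem J; last by rewrite (xm _ k).
  by case: x0 => h ->; rewrite big1.
pose i0 := Ordinal mc; pose x' := kbase mc x; pose x'' := klink mc x.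
have x'm : supported_below m x' by apply: kbase_supported.
have x''m : supported_below m x'' by apply: klink_supported.
have Kx'' : Koszul x'' =1 (fun=> 0).
  move=> J; have [iJ|iJ] := boolP (i0 \in J).
    by apply: (Koszul_supported x''m) iJ _.
  by rewrite -Koszul_link // Kx.
have below0 k : below set0 k = 0%N by apply: eq_card0 => j; rewrite !inE.
(* In degree 0 the cycle condition says that [f i0 *: x'' set0] is minus the value of [Koszul x'] at
   [set0], hence a combination of the first [m] elements; regularity removes [f i0]. *)
have x''0 : in_ideal_mul [pred j : 'I_c | (j < m)%N] (x'' set0).
  apply: (f_reg i0); have /eqP := Kx set0.
  rewrite (Koszul_base (mc := mc)) ?inE // below0 mul1r addrC addr_eq0.
  move=> /eqP ->.
  by rewrite -scaleN1r; apply/in_ideal_mulZ/Koszul_set0.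
have [y0 [y0m Ky0]] := IHm x'' (ltnW mc) x''m Kx'' x''0.
have [h hE] := x0.
(* [h i0] is the coefficient of [f i0] in [x set0]; subtracting that term leaves a combination of
   the first [m] elements. *)
pose y'' J := if J == set0 then h i0 else y0 J.
have y''m : supported_below m y''.
  move=> J k kJ mk; rewrite /y''.
  case: eqP kJ => [->|_ kJ]; first by rewrite inE.
  exact: y0m kJ mk.
have Ky'' : Koszul y'' =1 x''.
  move=> J; rewrite -Ky0; apply: Koszul_eq => k kJ.
  by rewrite /y''; case: eqP => // /setP/(_ k); rewrite !inE eqxx.
(* By [Koszul_base], a preimage of [x] with link [y''] must have a base whose boundary is the [u]
   below. *)
pose sy J := (-1) ^+ below J i0 *: y'' J.
pose u J := x' J - f i0 *: sy J.
have um : supported_below m u.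
  move=> J k kJ mk; rewrite /u /sy (x'm _ k) // (y''m _ k) //.
  by rewrite !scaler0 subr0.
have Ku : Koszul u =1 (fun=> 0).
  move=> J; have [iJ|iJ] := boolP (i0 \in J).
    by apply: (Koszul_supported um) iJ _.
  rewrite KoszulB Koszul_sign // Ky'' -[RHS](Kx J) (Koszul_base x iJ).
  by rewrite scalerN opprK scalerA [f _ * _]mulrC.
have u0 : in_ideal_mul [pred j : 'I_c | (j < m)%N] (u set0).
  exists h; rewrite /u /sy /x' /kbase inE below0 scale1r /y'' eqxx hE.
  rewrite (bigD1 i0) //= [LHS]addrC addKr; apply: eq_bigl => k /=.
  by rewrite -(inj_eq val_inj) /= ltnS [RHS]ltn_neqAle andbC.
have [y' [y'm Ky']] := IHm u (ltnW mc) um Ku u0.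
pose y J := if i0 \in J then y'' (J :\ i0) else y' J.
have ym : supported_below m.+1 y.
  move=> J k kJ mk; rewrite /y; case: ifPn => _; last exact: y'm kJ (ltnW mk).
  apply: (y''m _ k); rewrite ?(ltnW mk) // !inE kJ andbT -(inj_eq val_inj) /=.
  by rewrite gtn_eqF.
have base_y : kbase mc y =1 y'.
  move=> J; rewrite /kbase /y -/i0; case: (boolP (i0 \in J)) => // iJ.
  by rewrite (y'm J i0).
have link_y : klink mc y =1 y''.
  move=> J; rewrite /klink /y -/i0; case: (boolP (i0 \in J)) => iJ.
    by rewrite (y''m _ i0).
  by rewrite setU11 setU1K.
exists y; split=> // J; have [iJ|iJ] := boolP (i0 \in J).
  rewrite -(setD1K iJ); have iJ' : i0 \notin J :\ i0 by rewrite !inE eqxx.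
  rewrite (Koszul_link ym) // (Koszul_eq (y := y'')) // Ky''.
  by rewrite /x'' /klink (negbTE iJ').
rewrite (Koszul_base (mc := mc)) // (Koszul_eq (y := y')) // Ky' link_y.
by rewrite /u /sy scalerA [f _ * _]mulrC subrK /x' /kbase (negbTE iJ).
Qed.

End KoszulFunctions.

(** * Coordinates on tensor products with exterior powers *)

Section Coordinates.
Variables (S : comPzRingType) (c : nat).
Implicit Types (q : nat) (A : {set 'I_c}).

(** Indexing by arbitrary sets, with value 0 off cardinality [q], gives all degrees the same index
    type, as in [Koszul]. *)
Definition ext_coef q A (x : exterior S c q) : S :=
  \sum_(I : subsets c q | sval I == A) (x I : S).

Lemma ext_coef_linear q A : linear (ext_coef A : exterior S c q -> S^o).
Proof.
move=> a x y; rewrite /ext_coef scaler_sumr -big_split /=.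
by apply: eq_bigr => I _; rewrite !ffunE.
Qed.

HB.instance Definition _ q A := GRing.isLinear.Build S (exterior S c q) S^o
  *:%R (ext_coef A) (@ext_coef_linear q A).

Lemma ext_coef_val q (x : exterior S c q) (I : subsets c q) :
  ext_coef (sval I) x = x I.
Proof. by rewrite /ext_coef (big_pred1 I). Qed.

Lemma ext_coef_card q (x : exterior S c q) A : #|A| != q -> ext_coef A x = 0.
Proof.
move=> Aq; apply: big_pred0 => I; apply: contraNF Aq => /eqP <-.
exact: (valP I).
Qed.

Definition ebasis q (I : subsets c q) : exterior S c q :=
  [ffun J => (J == I)%:R].

Lemma exterior_sum q (x : exterior S c q) : x = \sum_I (x I : S) *: ebasis I.
Proof.
apply/ffunP => J; rewrite sum_ffunE (bigD1 J) //= big1 ?addr0.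
  by rewrite !ffunE eqxx /GRing.scale /= mulr1.
by move=> I IJ; rewrite !ffunE eq_sym (negbTE IJ) scaler0.
Qed.

(** The sets [I] containing [k] with [I :\ k = A] are the [k |: A] with [k] outside [A], and [k] is
    not below itself, so the signs agree. *)
Lemma ext_coef_koszul (f : 'I_c -> S) q (x : exterior S c q.+1) A :
  ext_coef A (koszul_diff f x) =
  \sum_(k | k \notin A) ((-1) ^+ below A k * f k) * ext_coef (k |: A) x.
Proof.
have [/eqP Aq|Aq] := boolP (#|A| == q); last first.
  rewrite ext_coef_card // big1 // => k kA.
  by rewrite ext_coef_card ?mulr0 // cardsU1 kA.
have [J JA] : exists J : subsets c q, sval J = A.
  by exists (exist _ A (introT eqP Aq)).
move: JA Aq => <- _ {A}.
rewrite ext_coef_val ffunE.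
rewrite (exchange_big_dep predT) //= [RHS]big_mkcond; apply: eq_bigr => k _.
have [kA|kA] := boolP (k \in sval J).
  apply: big_pred0 => I; apply/negP => /andP[_ /eqP IJ]; move: kA.
  have -> : sval J = sval I :\ k by rewrite IJ.
  by rewrite !inE eqxx.
rewrite /ext_coef mulr_sumr; apply: eq_big => [I|I /andP[kI /eqP IA]].
  apply/andP/eqP => [[kI /eqP <-]|->]; first by rewrite setD1K.
  by rewrite setU11 setU1K.
congr (_ ^+ _ * _ * _); apply: eq_card => j; rewrite !inE -IA !inE.
by case: eqP => // ->; rewrite ltnn andbF.
Qed.

Variable V : lmodType S.
Local Notation VK q := (tensor V (exterior S c q)).

Fact coef_bilinear q A :
  bilinear_map (fun (v : V) (x : exterior S c q) => ext_coef A x *: v).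
Proof.
split=> [x a v w | v a x y]; first by rewrite scalerDr !scalerA mulrC.
by rewrite linearP scalerDl -scalerA.
Qed.

Definition coef q A (z : VK q) : V :=
  tensor_lift (fun (v : V) (x : exterior S c q) => ext_coef A x *: v) z.

HB.instance Definition _ q A := GRing.isLinear.Build S (VK q) V
  *:%R (@coef q A) (tensor_lift_linear (@coef_bilinear _ A)).

Lemma coef_tens q A (v : V) (x : exterior S c q) :
  coef A (tens v x) = ext_coef A x *: v.
Proof. exact: (tensor_lift_tens (@coef_bilinear _ A)). Qed.

Lemma coef_card q A (z : VK q) : #|A| != q -> coef A z = 0.
Proof.
move=> Aq; elim/tensor_ind: z => [|x y xA yA|v x]; first by rewrite linear0.
  by rewrite linearD /= xA yA addr0.
by rewrite coef_tens ext_coef_card ?scale0r.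
Qed.

Fact tens_ebasis_linear q (I : subsets c q) :
  linear (fun v : V => tens v (ebasis I)).
Proof. by move=> a v w; rewrite tensDl tensZl. Qed.

Definition tens_ebasis q (I : subsets c q) (v : V) : VK q := tens v (ebasis I).

HB.instance Definition _ q (I : subsets c q) := GRing.isLinear.Build S V (VK q)
  *:%R (tens_ebasis I) (tens_ebasis_linear I).

Lemma coef_tens_ebasis q (I J : subsets c q) v :
  coef (sval J) (tens_ebasis I v) = if J == I then v else 0.
Proof.
rewrite coef_tens ext_coef_val ffunE; case: eqP => _; first by rewrite scale1r.
by rewrite scale0r.
Qed.

Lemma tensor_coef_sum q (z : VK q) :
  z = \sum_I tens_ebasis I (coef (sval I) z).
Proof.
elim/tensor_ind: z => [|x y xE yE|v x].
- by rewrite big1 // => I _; rewrite !linear0.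
- rewrite {1}xE {1}yE -big_split; apply: eq_bigr => I _.
  by rewrite !linearD.
rewrite {1}[x]exterior_sum (big_morph _ (tensDr v) (id1 := 0)); last first.
  by rewrite -[0 in LHS](scale0r 0) tensZr scale0r.
apply: eq_bigr => I _; rewrite coef_tens ext_coef_val linearZ /=.
by rewrite tensZr.
Qed.

Lemma coef_inj q (z z' : VK q) : (forall A, coef A z = coef A z') -> z = z'.
Proof.
move=> zz'; rewrite [z]tensor_coef_sum [z']tensor_coef_sum.
by apply: eq_bigr => I _; rewrite zz'.
Qed.

Lemma coef_surj q (y : {set 'I_c} -> V) :
  exists z : VK q, forall A, #|A| == q -> coef A z = y A.
Proof.
exists (\sum_I tens_ebasis I (y (sval I))) => A Aq.
have [J JA] : exists J : subsets c q, sval J = A by exists (exist _ A Aq).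
rewrite linear_sum (bigD1 J) // big1 => [|I IJ] /=.
  by rewrite addr0 -JA coef_tens_ebasis eqxx.
by rewrite -JA coef_tens_ebasis eq_sym (negbTE IJ).
Qed.

Lemma free_tensor_exterior q : free_module V -> free_module (VK q).
Proof.
move=> freeV.
apply: (@free_biproduct S (subsets c q) (fun=> V) (VK q)
          (fun I => tens_ebasis I) (fun I => coef (sval I))) => //.
- by move=> I v /=; rewrite coef_tens_ebasis eqxx.
- by move=> I J v IJ /=; rewrite coef_tens_ebasis eq_sym (negbTE IJ).
- exact: tensor_coef_sum.
Qed.

Variable f : 'I_c -> S.

Lemma coef_koszul q (z : VK q.+1) A :
  coef A (tensor_map (@idfun V) (@koszul_diff S c f q) z) =
  Koszul f (fun B => coef B z) A.
Proof.
rewrite /Koszul; elim/tensor_ind: z => [|x y xE yE|v x].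
- by rewrite !linear0 big1 // => k _; rewrite linear0 scaler0.
- rewrite !linearD /= xE yE -big_split; apply: eq_bigr => k _.
  by rewrite linearD scalerDr.
rewrite tensor_map_tens coef_tens ext_coef_koszul scaler_suml.
by apply: eq_bigr => k _; rewrite coef_tens scalerA.
Qed.

(** This treats all degrees at once: for [q > 0] the condition at [set0] is automatic, and for
    [q = 0] the cycle condition is. *)
Lemma koszul_tensor_exact q (z : VK q) :
  regular_on f V -> Koszul f (fun A => coef A z) =1 (fun=> 0) ->
  in_ideal_mul f predT (coef set0 z) ->
  exists w : VK q.+1, tensor_map (@idfun V) (@koszul_diff S c f q) w = z.
Proof.
move=> f_reg Kz z0.
have [y [_ Ky]] : exists y, supported_below c y /\
    Koszul f y =1 (fun A => coef A z).
  apply: (Koszul_acyclic f_reg) => //.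
    by move=> J k _; rewrite leqNgt ltn_ord.
  case: z0 => h ->; exists h; apply: eq_bigl => k; exact/esym/ltn_ord.
(* [y] may have terms in every degree; only those of degree [q.+1] affect the boundary in degree
   [q], and [w] keeps just these. *)
have [w wy] := coef_surj q.+1 y.
exists w; apply: coef_inj => A; rewrite coef_koszul.
have [Aq|Aq] := boolP (#|A| == q); last first.
  rewrite coef_card //; apply: big1 => k kA.
  by rewrite coef_card ?scaler0 // cardsU1 kA.
by rewrite -Ky; apply: Koszul_eq => k kA; rewrite wy // cardsU1 kA.
Qed.

End Coordinates.

(** * Reduction modulo the ideal generated by the sequence *)

Section QuotientBaseChange.
Variables (S : comPzRingType) (c : nat) (f : 'I_c -> S) (V : lmodType S).
Local Notation phi := (quot_proj f).
Local Notation IV := (@in_ideal_mul S c f V predT).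

Definition residue (v : V) : base_change phi V := tens (1 : scalars phi) v.

Lemma in_ideal_mul0 : IV 0.
Proof. by exists (fun=> 0); rewrite big1 // => i _; rewrite scaler0. Qed.

Lemma in_ideal_mulD v w : IV v -> IV w -> IV (v + w).
Proof.
move=> vI wI; rewrite -[w]opprK; apply: in_ideal_mulB => //.
by rewrite -[- w]sub0r; apply: in_ideal_mulB => //; apply: in_ideal_mul0.
Qed.

Lemma in_ideal_mul_scale a b v :
  phi a = phi b -> IV (a *: v - b *: v).
Proof.
move=> /quot_projP/asboolP[u ab]; exists (fun i => u i *: v).
rewrite -scalerBl ab scaler_suml; apply: eq_bigr => i _.
by rewrite scalerA mulrC.
Qed.

Let lift_repr (s : seq (scalars phi * V)) : V :=
  \sum_(u <- s) quot_repr (u.1 : quot_ring f) *: u.2.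

(* The class of [lift_repr s] in [V / IV] only depends on the tensor [tsum s],
   hence [R (x) V -> V / IV] is well defined without constructing [V / IV]. *)
Lemma tensor_eqv_lift_repr s t :
  tensor_eqv s t -> IV (lift_repr s - lift_repr t).
Proof.
elim=> {s t} [s|s t _ IH|s t u _ IH1 _ IH2|s s' t t' _ IH1 _ IH2|s t|n|m
  |m m' n|m n n'|a m n]; rewrite /lift_repr ?big_cat ?big_cons ?big_nil /=.
- by rewrite subrr; apply: in_ideal_mul0.
- by rewrite -opprB -scaleN1r; apply: in_ideal_mulZ.
- rewrite -[_ - _](subrKA (lift_repr t)); exact: in_ideal_mulD.
- by rewrite opprD addrACA; apply: in_ideal_mulD.
- by rewrite addrC subrr; apply: in_ideal_mul0.
- rewrite !addr0 subr0 -[_ *: n]subr0 -[X in _ - X](scale0r n).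
  by apply: in_ideal_mul_scale; rewrite quot_reprK rmorph0.
- by rewrite scaler0 !addr0 subr0; apply: in_ideal_mul0.
- rewrite !addr0 -scalerDl; apply: in_ideal_mul_scale.
  by rewrite rmorphD /= !quot_reprK.
- by rewrite !addr0 scalerDr subrr; apply: in_ideal_mul0.
- rewrite !addr0 scalerA; apply: in_ideal_mul_scale.
  by rewrite rmorphM /= !quot_reprK mulrC.
Qed.

(** This identifies [R (x) V] with [V / IV]: lifting [1 (x) v] back gives [v] modulo [IV], while
    each [f i] crosses the tensor sign and vanishes in [R]. *)
Lemma residue_eq0 v : residue v = 0 <-> IV v.
Proof.
split=> [v0|[h ->]].
  have /tensor_eqv_lift_repr : tensor_eqv [:: (1 : scalars phi, v)] [::].
    by apply/tsumP.
  rewrite /lift_repr big_seq1 big_nil subr0 /= => v1.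
  rewrite -[v](subrK (quot_repr (1 : quot_ring f) *: v)).
  apply: in_ideal_mulD => //; rewrite -{1}[v]scale1r.
  by apply: in_ideal_mul_scale; rewrite quot_reprK rmorph1.
rewrite /residue (big_morph _ (tensDr (1 : scalars phi)) (id1 := 0)).
  apply: big1 => i _; rewrite tensZr -tensZl.
  have -> : f i *: (1 : scalars phi) = 0 *: (1 : scalars phi).
    rewrite /GRing.scale /= /restrict_scale; congr (_ *: _).
    apply/quot_projP/asboolP; exists (fun j => (j == i)%:R).
    rewrite subr0 (bigD1 i) //= eqxx mul1r big1 ?addr0 // => j /negbTE ->.
    by rewrite mul0r.
  by rewrite tensZl scale0r.
by rewrite -[0 in LHS](scale0r 0) tensZr scale0r.
Qed.

Lemma residueD : {morph residue : v w / v + w}.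
Proof. exact: tensDr. Qed.

Lemma residueB : {morph residue : v w / v - w}.
Proof.
by move=> v w; apply/eqP; rewrite eq_sym subr_eq -residueD subrK.
Qed.

Lemma residueZ a v : residue (a *: v) = phi a *: residue v.
Proof.
rewrite /residue tensZr -tensZl /GRing.scale /= /base_change_scale.
by rewrite tensor_map_tens.
Qed.

Lemma residue_surj (x : base_change phi V) : exists v, residue v = x.
Proof.
elim/tensor_ind: x => [|x y [v <-] [w <-]|b v].
- by exists 0; apply/residue_eq0/in_ideal_mul0.
- by exists (v + w); rewrite residueD.
exists (quot_repr (b : quot_ring f) *: v).
rewrite /residue tensZr -tensZl; congr tens.
exact: etrans (congr1 (fun a : quot_ring f => a * 1) (quot_reprK b)) (mulr1 _).
Qed.

End QuotientBaseChange.

Lemma base_change_residue (S : comPzRingType) (c : nat) (f : 'I_c -> S)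
    (V W : lmodType S) (g : {linear V -> W}) v :
  base_change_map (quot_proj f) g (residue f v) = residue f (g v).
Proof. exact: tensor_map_tens. Qed.

(** * The total complex and its filtration by the index of [G] *)

Section TotalComplex.
Variables (S : comPzRingType) (c : nat) (G : nat -> lmodType S).
Local Notation GK := (GK c G).
Local Notation GK_term := (GK_term c G).

Definition GK_proj n (k : 'I_n.+1) (x : GK n) : GK_term k (n - k) := x k.

Lemma GK_proj_linear n (k : 'I_n.+1) : linear (@GK_proj n k).
Proof. by move=> a x y; rewrite /GK_proj !ffunE. Qed.

HB.instance Definition _ n (k : 'I_n.+1) := GRing.isLinear.Build S (GK n)
  (GK_term k (n - k)) *:%R (@GK_proj n k) (@GK_proj_linear n k).

Definition GK_inj n (k : 'I_n.+1) (w : GK_term k (n - k)) : GK n :=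
  [ffun p => dfwith (fun p : 'I_n.+1 => 0 : GK_term p (n - p)) w p].

Lemma GK_inj_in n (k : 'I_n.+1) (w : GK_term k (n - k)) : GK_inj w k = w.
Proof. by rewrite ffunE dfwith_in. Qed.

Lemma GK_inj_out n (k p : 'I_n.+1) (w : GK_term k (n - k)) :
  k != p -> GK_inj w p = 0.
Proof. by move=> kp; rewrite ffunE dfwith_out. Qed.

Lemma GK_inj_linear n (k : 'I_n.+1) : linear (@GK_inj n k).
Proof.
move=> a v w; apply/ffunP=> p.
transitivity (a *: GK_inj v p + GK_inj w p); last by rewrite !ffunE.
have [<-|kp] := eqVneq k p; first by rewrite !GK_inj_in.
by rewrite !GK_inj_out // scaler0 addr0.
Qed.

HB.instance Definition _ n (k : 'I_n.+1) := GRing.isLinear.Build S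
  (GK_term k (n - k)) (GK n) *:%R (@GK_inj n k) (@GK_inj_linear n k).

Lemma free_GK n : (forall p, free_module (G p)) -> free_module (GK n).
Proof.
move=> freeG.
apply: (@free_biproduct S 'I_n.+1 (fun p => GK_term p (n - p)) (GK n)
          (fun p => @GK_inj n p) (fun p => @GK_proj n p)).
- by move=> k w; apply: GK_inj_in.
- by move=> k p w kp; apply: GK_inj_out.
- move=> x; apply/ffunP=> p; rewrite -[RHS]/(GK_proj p _) linear_sum.
  rewrite (bigD1 p) //= big1 => [|k kp]; last exact: GK_inj_out.
  by rewrite addr0 /GK_proj GK_inj_in.
- by move=> p; apply: free_tensor_exterior.
Qed.

Variables (f : 'I_c -> S) (dG : forall p, {linear G p.+1 -> G p}).
Variables (t : operators c G) (t_CI : higher_CI_operators f dG t).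

(** Indices are variables tied by equations so that the lemma applies to expressions such as [k - k]
    or [n.+1 - k]; likewise for [coef_t1] and [t0_exact]. *)
Lemma coef_t0 i p q q' (z : GK_term p q) A : i = 0%N -> q = q'.+1 ->
  coef A (t i p q p q' z) = (-1) ^+ p *: Koszul f (fun B => coef B z) A.
Proof.
move=> i0 qE; subst i q; rewrite -coef_koszul -linearZ /=; congr (coef A _).
elim/tensor_ind: z => [|x y xE yE|g x]; first by rewrite !linear0.
  by rewrite !linearD /= xE yE.
by rewrite (CI_t0 t_CI) tensor_map_tens tensZr.
Qed.

Lemma coef_t1 i p q q' (z : GK_term p.+1 q) A : i = 1%N -> q = q' ->
  coef A (t i p.+1 q p q' z) = dG p (coef A z).
Proof.
move=> i1 qE; subst i q'; rewrite (CI_t1 t_CI).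
elim/tensor_ind: z => [|x y xE yE|g x]; first by rewrite !linear0.
  by rewrite !linearD /= xE yE.
by rewrite tensor_map_tens !coef_tens linearZ.
Qed.

Lemma t0_exact i p q q' (z : GK_term p q) :
  regular_on f (G p) -> i = 0%N -> q' = q.+1 ->
  Koszul f (fun A => coef A z) =1 (fun=> 0) ->
  in_ideal_mul f predT (coef set0 z) ->
  exists w : GK_term p q', t i p q' p q w = z.
Proof.
move=> f_reg i0 qE Kz z0; have [w wE] := koszul_tensor_exact f_reg Kz z0.
(* The factor [(-1) ^+ p] cancels the sign carried by [t_0]. *)
subst i q'; exists ((-1) ^+ p *: w); apply: coef_inj => A.
rewrite !linearZ /= coef_t0 // scalerA -expr2 sqrr_sign scale1r.
by rewrite -coef_koszul wE.
Qed.

Lemma GK_diffE n (x : GK n.+1) p' :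
  GK_diff t n x p' = \sum_(p : 'I_n.+2 | (p' <= p)%N)
      t (p - p')%N p (n.+1 - p)%N p' (n - p')%N (x p).
Proof. by rewrite ffunE. Qed.

Lemma GK_diff_inj n (k : 'I_n.+2) (w : GK_term k (n.+1 - k)) (p : 'I_n.+1) :
  GK_diff t n (GK_inj w) p =
  if (p <= k)%N then t (k - p)%N k (n.+1 - k)%N p (n - p)%N w else 0.
Proof.
have out j : j != k -> GK_inj w j = 0 by rewrite eq_sym; apply: GK_inj_out.
rewrite GK_diffE; case: ifPn => pk.
  rewrite (bigD1 k) //= GK_inj_in big1 ?addr0 // => j /andP[_ jk].
  by rewrite out // linear0.
apply: big1 => j pj; rewrite out ?linear0 //.
by apply: contraNneq pk => <-.
Qed.

(** The component of the square from index [p] to index [r] is the sum of the [t_i t_j] with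
    [i + j = p - r], which is [CI_comp]. *)
Lemma GK_diffK n (x : GK n.+2) : GK_diff t n (GK_diff t n.+1 x) = 0.
Proof.
apply/ffunP=> r; rewrite [RHS]ffunE GK_diffE.
(* The intermediate indices are free numbers, so different expressions for them are matched by
   equalities in [nat], without transport between modules. *)
pose psi (p : 'I_n.+3) (j a b : nat) : GK_term r (n - r) :=
  t (p - r - j)%N a b r (n - r)%N (t j p (n.+2 - p)%N a b (x p)).
transitivity (\sum_(p : 'I_n.+3 | (r <= p)%N)
  \sum_(k : 'I_n.+2 | (r <= k <= p)%N) psi p (p - k)%N k (n.+1 - k)%N).
  rewrite (exchange_big_dep (fun k : 'I_n.+2 => (r <= k)%N)) /=; last first.
    by move=> p k _ /andP[].
  apply: eq_bigr => k rk; rewrite GK_diffE linear_sum /=.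
  apply: eq_big => [p|p kp].
    by rewrite rk; case: leqP => [kp|]; rewrite ?andbF ?(leq_trans rk kp).
  rewrite /psi; congr (t _ _ _ _ _ _).
  by rewrite -subnDA [(r + _)%N]addnC subnDA subKn.
apply: big1 => p rp.
have pn : (p <= n.+2)%N by rewrite -ltnS.
have rn : (r <= n)%N by rewrite -ltnS.
have h1 : p = (r + (p - r))%N :> nat by rewrite subnKC.
have h2 : (n.+2 - p + (p - r))%N = (n - r).+2.
  by rewrite addnBA // subnK // !subSn // ltnW.
rewrite -[RHS](CI_comp t_CI h1 h2 (x p)).
pose h (k : 'I_n.+2) : 'I_(p - r).+1 := inord (p - k).
pose h' (j : 'I_(p - r).+1) : 'I_n.+2 := inord (p - j).
rewrite (reindex_onto h' h) /=; last first.
  move=> k /andP[rk kp]; apply: ord_inj.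
  by rewrite !inordK ?subKn // ltnS leq_sub2l.
have jp (j : 'I_(p - r).+1) : (j <= p - r)%N by rewrite -ltnS.
have h'E (j : 'I_(p - r).+1) : (0 < n.+2 - p + j)%N -> h' j = (p - j)%N :> nat.
  move=> qj; rewrite inordK //; have := jp j; lia.
have hE (j : 'I_(p - r).+1) : (0 < n.+2 - p + j)%N -> (p - h' j)%N = j.
  by move=> qj; rewrite h'E // subKn // (leq_trans (jp j)) // leq_subr.
(* With [k = p - j], the bound [k < n.+2] fails only for [p = n.+2] and [j = 0], exactly the term
   that [CI_comp] leaves out. *)
have condE (j : 'I_(p - r).+1) :
    ((r <= h' j <= p)%N && (h (h' j) == j)) = (0 < n.+2 - p + j)%N.
  apply/idP/idP=> [/andP[/andP[rh hp] /eqP/(congr1 val) /=]|qj].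
    rewrite inordK ?ltnS ?leq_sub2l // => <-.
    by rewrite addn_gt0 !subn_gt0; have := ltn_ord (h' j); lia.
  have hhE : h (h' j) = j.
    by apply: ord_inj; rewrite {1}/h inordK ?hE // ltnS jp.
  by rewrite hhE h'E // eqxx andbT; have := jp j; lia.
apply: eq_big => [j|j]; rewrite condE // => qj.
rewrite -[RHS]/(psi p j (p - j)%N (n.+2 - p + j).-1) hE // h'E //.
by congr (psi _ _ _ _); have := jp j; lia.
Qed.



(** [K_0], here in degree [n - n], has rank one, so its coordinate at [set0] identifies
    [G_n (x) K_0] with [G_n]. *)
Definition GK_top n (x : GK n) : G n := coef set0 (x ord_max).

Lemma GK_top_linear n : linear (@GK_top n).
Proof. by move=> a x y; rewrite /GK_top !ffunE linearP. Qed.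

HB.instance Definition _ n := GRing.isLinear.Build S (GK n) (G n) *:%R
  (@GK_top n) (@GK_top_linear n).

Lemma GK_top_surj n (g : G n) : exists x : GK n, GK_top x = g.
Proof.
have [w wE] := @coef_surj S c (G n) (n - n) (fun=> g).
exists (@GK_inj n ord_max w).
by rewrite /GK_top GK_inj_in wE // cards0 subnn.
Qed.

(** Index [n] receives [dG] from index [n.+1], and from index [n] a Koszul boundary, whose value at
    [set0] lies in the ideal times [G n]. *)
Lemma GK_top_diff n (x : GK n.+1) :
  in_ideal_mul f predT (GK_top (GK_diff t n x) - dG n (GK_top x)).
Proof.
rewrite /GK_top GK_diffE big_mkcond !big_ord_recr /= leqnn leqnSn.
rewrite big1 => [|i _]; last by rewrite leqNgt ltn_ord.
rewrite add0r linearD /= coef_t0 ?subnn ?subSn ?subnn //.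
rewrite coef_t1 ?subSnn ?subnn // (@addrK (G n)).
apply: in_ideal_mulZ; set K := (fun B => _).
have [|h ->] := @Koszul_set0 _ _ f _ c K.
  by move=> J k _; rewrite leqNgt ltn_ord.
by exists h; apply: eq_bigl => i; apply: ltn_ord.
Qed.

Hypothesis f_reg : forall p, regular_on f (G p).

(** The top component is [t_0 w] for some [w] in [G_n (x) K_1]; placed at index [n], [w] reaches the
    top component only through [t_0]. *)
Lemma GK_top_exact n (x : GK n) :
  in_ideal_mul f predT (GK_top x) ->
  exists y : GK n.+1, (x - GK_diff t n y) ord_max = 0.
Proof.
move=> x0; pose k : 'I_n.+2 := widen_ord (leqnSn _) ord_max.
have [||A||w wE] :=
  @t0_exact (n - n) n (n - n) (n.+1 - n) (x ord_max) (@f_reg n).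
- exact: subnn.
- by rewrite subSn.
- rewrite /Koszul big1 // => i iA.
  by rewrite coef_card ?scaler0 // cardsU1 iA subnn.
- exact: x0.
exists (@GK_inj n.+1 k w).
rewrite -[LHS]/(GK_proj ord_max _) linearB /= /GK_proj GK_diff_inj /=.
by rewrite leqnn wE subrr.
Qed.

(** Induction on the number [k] of components left. As [k <= n.+1], these all have positive Koszul
    degree, where [t_0] is exact. *)
Lemma GK_descent n (x : GK n.+1) k :
  GK_diff t n x = 0 -> (k <= n.+1)%N ->
  (forall p : 'I_n.+2, (k <= p)%N -> x p = 0) ->
  exists y : GK n.+2, GK_diff t n.+1 y = x.
Proof.
elim: k x => [|k IHk] x Tx kn xk.
  by exists 0; rewrite linear0; apply/ffunP=> p; rewrite ffunE xk.
pose k0 : 'I_n.+1 := Ordinal kn; pose k1 : 'I_n.+2 := widen_ord (leqnSn _) k0.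
pose k2 : 'I_n.+3 := widen_ord (leqnSn _) k1.
(* All components of [x] above [k] vanish, so component [k] of its boundary reduces to [t_0]. *)
have Txk : t (k - k)%N k (n.+1 - k)%N k (n - k)%N (x k1) = 0.
  have := congr1 (fun y : GK n => y k0) Tx.
  rewrite GK_diffE ffunE (bigD1 k1) //= big1 ?addr0 // => p /andP[kp pk1].
  rewrite xk ?linear0 // ltn_neqAle kp andbT.
  by apply: contraNneq pk1 => kp'; apply/eqP/ord_inj.
have [||A||w wE] :=
  @t0_exact (k - k) k (n.+1 - k) (n.+2 - k) (x k1) (@f_reg k).
- exact: subnn.
- by rewrite subSn // ltnW.
- have := congr1 (coef A) Txk; rewrite coef_t0 ?subnn ?subSn // linear0.
  by move/(congr1 (GRing.scale ((-1) ^+ k))); rewrite scalerA -expr2 sqrr_sign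
    scale1r scaler0.
- rewrite coef_card; last by rewrite cards0 eq_sym subn_eq0 -ltnNge.
  exact: in_ideal_mul0.
(* No [t_i] raises the index, so the boundary of [y] leaves the components above [k] zero. *)
pose y : GK n.+2 := @GK_inj n.+2 k2 w.
have [||p kp|z Tz] := IHk (x - GK_diff t n.+1 y).
- by rewrite linearB /= GK_diffK Tx subrr.
- exact: ltnW.
- rewrite -[LHS]/(GK_proj p _) linearB /= /GK_proj GK_diff_inj /=.
  have [kp'|pk] := ltnP k p; first by rewrite xk ?subr0.
  have {kp pk} -> : p = k1 by apply: ord_inj; apply/eqP; rewrite eqn_leq kp pk.
  by rewrite wE subrr.
by exists (z + y); rewrite linearD /= Tz subrK.
Qed.

End TotalComplex.

(** * Comparison of the total complex with the resolution over the quotient ring *)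

Theorem theorem7p3 (S : comPzRingType) (c : nat) (f : 'I_c -> S)
    (f_regular : regular_sequence f)
    (G : nat -> lmodType S) (dG : forall p, {linear G p.+1 -> G p})
    (G_free : forall p, free_module (G p))
    (M : lmodType (quot_ring f))
    (RG_resolution :
       is_free_resolution (fun p => base_change (quot_proj f) (G p))
         (fun p => base_change_map (quot_proj f) (dG p)) M)
    (t : operators c G)
    (t_CI : higher_CI_operators f dG t) :
  is_free_resolution (GK c G) (fun n => GK_diff t n) (restrict (quot_proj f) M).
Proof.
have f_reg p : regular_on f (G p) by apply: free_regular_on.
case: RG_resolution => _ RG_exact [epsR [epsR_exact epsR_surj]].
pose rho n (x : GK c G n) := residue f (GK_top x).
have rhoB n : {morph rho n : x y / x - y}.
  by move=> x y; rewrite /rho linearB residueB.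
have rho_surj n r : exists x, rho n x = r.
  have [g <-] := residue_surj r; have [x <-] := @GK_top_surj _ c _ n g.
  by exists x.
have rho_diff n (x : GK c G n.+1) :
    rho n (GK_diff t n x) = base_change_map (quot_proj f) (dG n) (rho n.+1 x).
  apply/eqP; rewrite base_change_residue -subr_eq0 -residueB; apply/eqP.
  by apply/residue_eq0; apply: GK_top_diff.
have rho_ker n (x : GK c G n) : rho n x = 0 ->
    exists y, (x - GK_diff t n y) ord_max = 0.
  by move/residue_eq0; apply: (GK_top_exact t_CI).
(* Lift a preimage of [rho x] to the total complex; what remains of [x] has a
   trivial top component up to a boundary. *)
have lift n (x : GK c G n) (r : base_change (quot_proj f) (G n.+1)) :
    base_change_map (quot_proj f) (dG n) r = rho n x ->
    exists y : GK c G n.+1, (x - GK_diff t n y) ord_max = 0.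
  have [y <-] := rho_surj _ r; rewrite -rho_diff => yx.
  have [|w xw] := rho_ker n (x - GK_diff t n y); first by rewrite rhoB yx subrr.
  by exists (y + w); rewrite linearD opprD addrA.
(* [S] acts on the restriction of [M] through [quot_proj f], the scalar that [residueZ] produces. *)
have eps_linear : linear (fun x : GK c G 0 =>
    epsR (rho 0%N x) : restrict (quot_proj f) M).
  by move=> a x y; rewrite /rho linearP residueD residueZ linearP.
pose epsL := GRing.isLinear.Build S (GK c G 0) (restrict (quot_proj f) M) *:%R
  (fun x : GK c G 0 => epsR (rho 0%N x)) eps_linear.
pose eps : {linear GK c G 0 -> restrict (quot_proj f) M} :=
  HB.pack (fun x : GK c G 0 => epsR (rho 0%N x) : restrict (quot_proj f) M)
    epsL.
split=> [n|n x|]; first exact: free_GK.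
  split=> [Tx|[y <-]]; last exact: (GK_diffK t_CI).
  have /RG_exact[r /lift[y xy]] :
      base_change_map (quot_proj f) (dG n) (rho n.+1 x) = 0.
    by rewrite -rho_diff Tx /rho linear0; apply/residue_eq0/in_ideal_mul0.
  (* Starting at [n.+1] requires only the top component to be zero, which [xy] provides. *)
  have [|||z Tz] := @GK_descent _ _ _ _ _ _ t_CI f_reg n
    (x - GK_diff t n.+1 y) n.+1.
  - by rewrite linearB /= Tx (GK_diffK t_CI) subrr.
  - by [].
  - move=> p np; have -> : p = ord_max.
      by apply: ord_inj; apply/eqP; rewrite eqn_leq np -ltnS ltn_ord.
    exact: xy.
  by exists (z + y); rewrite linearD /= Tz subrK.
exists eps; split=> [x|m]; last first.
  by have [r <-] := epsR_surj m; have [x <-] := rho_surj 0%N r; exists x.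
split=> [/epsR_exact[r /lift[y xy]]|[y <-]]; last first.
  by apply/epsR_exact; exists (rho 1%N y); rewrite rho_diff.
(* In degree 0 the top component is the only one, so no descent remains. *)
exists y; apply/esym/eqP; rewrite -subr_eq0; apply/eqP/ffunP=> p.
have -> : p = ord_max by rewrite [p]ord1; apply: ord_inj.
by rewrite [RHS]ffunE; exact: xy.
Qed.
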